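(* Let $X$ be a barrelled topological sequence space (over $\mathbb{K}=\mathbb{R}$ or $\mathbb{C}$) in which $(e_n)_{n=1}^{\infty}$ forms a basis. Suppose that the unweighted unilateral backward shift $T$, given by $$T(u_1,u_2,u_3,\cdots)=(u_2,u_3,u_4,\cdots),$$ is a continuous linear operator on $X$ (in particular $T$ maps $X$ into $X$). Then $T$ is mixing if and only if $\lim_{n\to\infty}e_n=0$ in $X$.
   Context: $\mathbb{K}$ is $\mathbb{R}$ or $\mathbb{C}$; $\mathbb{N}^{\ast}$ is the set of positive integers; $\mathbb{K}^{\mathbb{N}^{\ast}}$ is the vector space of all scalar sequences $(u_n)_{n=1}^{\infty}$. For $n\geq 1$, $e_n$ is the sequence whose $n$-th term is $1$ and all other terms are $0$. A topological vector space is a vector space over $\mathbb{K}$ with a topology making addition and scalar multiplication continuous (such a topology is called a vector topology). A topological sequence space is a topological vector space $X$ that is a linear subspace of $\mathbb{K}^{\mathbb{N}^{\ast}}$ and in which convergence implies coordinatewise convergence (convergence of nets, i.e. each coordinate functional $(u_k)_{k}\mapsto u_n$ is continuous on $X$). A subset $A$ of a vector space is convex if $sA+tA\subseteq A$ whenever $0\leq t\leq 1$, $s+t=1$; balanced if $tA\subseteq A$ for $|t|\leq 1$; absolutely convex if it is balanced and convex; absorbing if for every $x$ there is $\varepsilon>0$ with $tx\in A$ for $|t|<\varepsilon$. A barrel in a topological vector space is an absolutely convex absorbing closed set. A locally convex space is a topological vector space in which every neighborhood of $0$ contains a convex neighborhood of $0$. A barrelled space is a locally convex space in which every barrel is a neighborhood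 of $0$. A sequence $(\mu_n)_{n=1}^{\infty}$ in a topological vector space $X$ is a basis if every $\mu\in X$ has a unique representation $\mu=\sum_{n=1}^{\infty}\alpha_n\mu_n$ (convergence in $X$) with scalars $\alpha_n\in\mathbb{K}$. (In particular $e_n\in X$ for all $n$ when $(e_n)$ is a basis of $X$.) A continuous linear operator $S$ on a topological vector space $X$ is mixing if for any pair $U,V$ of nonempty open subsets of $X$ there is a nonnegative integer $N$ such that $S^n(U)\cap V\neq\emptyset$ for all $n\geq N$. *)

(* Defs.v *)
From HB Require Import structures.
From mathcomp Require Import all_boot all_order all_algebra.
From mathcomp Require Import complex.
From mathcomp Require Import boolp classical_sets functions reals.
From mathcomp Require Import topology normedtype sequences convex.

Set Implicit Arguments.
Unset Strict Implicit.
Unset Printing Implicit Defensive.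

Import Order.TTheory GRing.Theory Num.Theory.
Import numFieldNormedType.Exports.

Local Open Scope classical_set_scope.
Local Open Scope ring_scope.

Section TopologicalVectorSpaces.
Context (K : numFieldType) (X : topologicalLmodType K).

Definition balanced_set (A : set X) : Prop :=
  forall (t : K) (x : X), `|t| <= 1 -> A x -> A (t *: x).

Definition absolutely_convex_set (A : set X) : Prop :=
  balanced_set A /\ convex_set A.

Definition absorbing_set (A : set X) : Prop :=
  forall x : X, exists2 eps : K, 0 < eps &
    forall t : K, `|t| < eps -> A (t *: x).

Definition barrel (A : set X) : Prop :=
  [/\ absolutely_convex_set A, absorbing_set A & closed A].

Definition locally_convex_space : Prop :=
  forall U : set X, nbhs (0 : X) U ->
    exists V : set X, [/\ nbhs (0 : X) V, convex_set V & V `<=` U].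

Definition barrelled_space : Prop :=
  locally_convex_space /\ forall A : set X, barrel A -> nbhs (0 : X) A.

Definition tvs_basis (mu : nat -> X) : Prop :=
  forall x : X, exists! alpha : nat -> K,
    series (fun n => alpha n *: mu n) @ \oo --> x.

Definition mixing (S : X -> X) : Prop :=
  forall U V : set X, open U -> U !=set0 -> open V -> V !=set0 ->
    exists N : nat, forall n : nat, (N <= n)%N ->
      (iter n S @` U) `&` V !=set0.

End TopologicalVectorSpaces.

(* Scalar sequences are functions [nat -> K], so the n-th term of a sequence
   indexed from 1 is its value at n - 1. The linear subspace is the predicate
   [E], and [\val : X -> (nat -> K)] is the inclusion. The topology of [X] is its
   own and need not be the one induced by the product topology. *)
HB.mixin Record isTopologicalSequenceSpace (K : numFieldType)
    (E : pred (nat -> K)) X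
    & @GRing.SubLmodule K (nat -> K) E X & TopologicalLmodule K X := {
  sequence_term_continuous :
    forall n : nat, continuous (fun u : X => (\val u : nat -> K) n : K^o)
}.

#[short(type="topologicalSequenceSpace")]
HB.structure Definition TopologicalSequenceSpace (K : numFieldType)
    (E : pred (nat -> K)) :=
  {X of @GRing.SubLmodule K (nat -> K) E X & TopologicalLmodule K X
        & isTopologicalSequenceSpace K E X}.

Definition unit_sequence (K : numFieldType) (n : nat) : nat -> K :=
  fun k => (k == n)%:R.

Definition backward_shift (K : numFieldType) (u : nat -> K) : nat -> K :=
  fun n => u n.+1.

(* Main.v *)
Require Import Defs.
From HB Require Import structures.
From mathcomp Require Import all_boot all_order all_algebra.
From mathcomp Require Import complex.
From mathcomp Require Import interval_inference.
From mathcomp Require Import boolp classical_sets functions reals.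
From mathcomp Require Import topology normedtype sequences convex.

Set Implicit Arguments.
Unset Strict Implicit.
Unset Printing Implicit Defensive.

Import Order.TTheory GRing.Theory Num.Theory.
Import numFieldNormedType.Exports.

Local Open Scope classical_set_scope.
Local Open Scope ring_scope.

(** Write [u_n] for the terms of [u] and [P_n u = u_n e_n] for the [n]-th term
of its basis expansion.

If [T] is mixing, fix a neighborhood [W] of 0 and let [A] be the set of all [u]
with [t P_n u] in [W] for all [n] and all scalars [t] with [|t| <= 1]. Each [P_n]
is continuous and linear, and [P_n u] tends to 0 as the general term of a
convergent series. So a uniform boundedness argument
([barrelled_equicontinuous]) applies: after shrinking [W] to a closed convex
neighborhood, [A] is a barrel, hence a neighborhood of 0. By mixing, for every
large [n] some [u] in [A] is moved by [T^n] to a sequence whose first term has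
modulus greater than 1. That first term is [u_n] (terms being numbered from 0),
so [e_n = u_n^-1 P_n u] with [|u_n^-1| <= 1] lies in [W].

Conversely, the finite linear combinations of the [e_n] are dense. If [u] in [U]
and [v] in [V] are two of them, let [w_n] be [v] shifted [n] places to the right.
It is a combination of a fixed number of terms [e_(n + k)] with fixed
coefficients, so [e_n --> 0] gives [w_n --> 0]. For large [n] the point [u + w_n]
is in [U], while [T^n (u + w_n) = v], since [T^n] kills [u] as soon as [n]
reaches its length. *)

(** * Limits and convex sets in topological vector spaces *)

Section TopologicalVectorSpaceTheory.
Context (K : numFieldType) (X : topologicalLmodType K).

Lemma cvg_lmodD (I : Type) (F : set_system I) (FF : Filter F) (f g : I -> X)
    (a b : X) :
  f @ F --> a -> g @ F --> b -> (fun i => f i + g i) @ F --> a + b.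
Proof.
move=> fa gb; apply: (cvg_comp (fun i => (f i, g i)) (fun x : X * X => x.1 + x.2)).
  exact: (cvg_pair fa gb).
exact: (add_continuous (a, b)).
Qed.

Lemma cvg_lmodB (I : Type) (F : set_system I) (FF : Filter F) (f g : I -> X)
    (a b : X) :
  f @ F --> a -> g @ F --> b -> (fun i => f i - g i) @ F --> a - b.
Proof.
move=> fa gb; apply: cvg_lmodD => //.
by apply: (cvg_comp g (fun x => - x)); [exact: gb|exact: opp_continuous].
Qed.

Lemma cvg_lmodZ (I : Type) (F : set_system I) (FF : Filter F) (s : I -> K^o)
    (f : I -> X) (a : K^o) (x : X) :
  s @ F --> a -> f @ F --> x -> (fun i => s i *: f i) @ F --> a *: x.
Proof.
move=> sa fx; apply: (cvg_comp (fun i => (s i, f i))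
  (fun z : K^o * X => z.1 *: z.2)).
  exact: (cvg_pair sa fx).
exact: (scale_continuous (a, x)).
Qed.

Lemma cvg_lmod_sum (I : Type) (F : set_system I) (FF : Filter F) (m : nat)
    (f : nat -> I -> X) (a : nat -> X) :
  (forall k, f k @ F --> a k) ->
  (fun i => \sum_(0 <= k < m) f k i) @ F --> \sum_(0 <= k < m) a k.
Proof.
move=> fa; elim: m => [|m IHm].
  rewrite big_nil (_ : (fun _ => _) = fun=> 0); first exact: cvg_cst.
  by apply/funext => i; rewrite big_nil.
rewrite big_nat_recr//= (_ : (fun _ => _) =
  fun i => \sum_(0 <= k < m) f k i + f m i); first exact: cvg_lmodD.
by apply/funext => i; rewrite big_nat_recr.
Qed.

Lemma cvg_series_term0 (x_ : nat -> X) (x : X) :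
  series x_ @ \oo --> x -> x_ @ \oo --> (0 : X).
Proof.
move=> xx; rewrite -(subrr x) (_ : x_ = fun n => series x_ n.+1 - series x_ n).
  apply: cvg_lmodB => //.
  exact: (cvg_comp _ _ (cvg_addnl 1) xx).
by apply/funext => n; rewrite seriesSB.
Qed.

(** Removes the interval type that bundles the weight [l] with its bounds. *)
Lemma convex_setP (A : set X) :
  convex_set A <-> forall (x y : X) (l : K), 0 <= l <= 1 -> A x -> A y ->
    A (l *: x + (1 - l) *: y).
Proof.
split=> [cA x y l l01 Ax Ay|cA x y l /set_mem Ax /set_mem Ay].
  case/andP: l01 => l0 l1.
  have := cA x y (Itv01 l0 l1) (mem_set Ax) (mem_set Ay).
  by move/set_mem.
by apply/mem_set/cA => //; rewrite ge0 le1.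
Qed.

(** A convex combination of two points is a continuous function of them, so points
of [A] close to [x] and [y] combine to points of [A] close to the combination of
[x] and [y]. *)
Lemma convex_closure (A : set X) : convex_set A -> convex_set (closure A).
Proof.
move=> /convex_setP cA; apply/convex_setP => x y l l01 Ax Ay B.
have /= : (fun z : X * X => l *: z.1 + (1 - l) *: z.2) @ nbhs (x, y) -->
    l *: x + (1 - l) *: y.
  apply: cvg_lmodD; apply: cvg_lmodZ; try exact: cvg_cst.
    exact: cvg_fst.
  exact: cvg_snd.
move=> /[apply] -[[P Q] [/= /Ax[a [Aa Pa]] /Ay[b [Ab Qb]]] PQB].
by exists (l *: a + (1 - l) *: b); split; [exact: cA|exact: (PQB (a, b))].
Qed.

(** Every topological vector space is regular: if [V - V] is contained in [W], so is
the closure of [V]. Local convexity lets [V], hence its closure, be convex. *)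
Lemma closed_convex_nbhs0 (W : set X) : locally_convex_space X -> nbhs 0 W ->
  exists C : set X, [/\ nbhs (0 : X) C, convex_set C, closed C & C `<=` W].
Proof.
move=> lcX W0.
have /= : (fun z : X * X => z.1 - z.2) @ nbhs ((0 : X), (0 : X)) --> (0 : X).
  rewrite -{3}(subrr 0); exact: (@sub_continuous X (0, 0)).
move=> /(_ W W0) [[P Q] [/= P0 Q0] PQW].
have [V [V0 cV VPQ]] := lcX _ (filterI P0 Q0).
exists (closure V); split.
- by apply: filterS V0; exact: subset_closure.
- exact: convex_closure.
- exact: closed_closure.
(* x + V is a neighborhood of x, so it meets V at some v,
   and x = v - (v - x) is in V - V *)
move=> x Vx.
have : nbhs x [set y | V (y - x)].
  have /= : (fun y : X => y - x) @ x --> (0 : X).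
    by rewrite -(subrr x); apply: cvg_lmodB; [exact: cvg_id|exact: cvg_cst].
  by apply.
move=> /Vx[v [/VPQ[Pv _] /VPQ[_ Qv]]].
by have := PQW (v, v - x) (conj Pv Qv); rewrite /= opprB addrC subrK.
Qed.

(** A null sequence is bounded. By continuity of scaling at [(0, 0)], a neighborhood
[Q] of 0 is mapped into [W] by all small scalars. This settles the terms in [Q];
the finitely many others are settled by continuity of scaling at [(0, x_ n)]. *)
Lemma null_sequence_bounded (W : set X) (x_ : nat -> X) : nbhs 0 W ->
  x_ @ \oo --> (0 : X) ->
  exists2 eps : K, 0 < eps & forall s n, `|s| < eps -> W (s *: x_ n).
Proof.
move=> W0 x0.
have Wscale (x : X) : \forall z \near ((0 : K^o), x), W (z.1 *: z.2).
  have := @scale_continuous K X (0, x); rewrite /continuous_at /= scale0r.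
  exact.
have [[P Q] [/= P0 Q0] PQW] := Wscale 0.
have [N _ NQ] := x0 _ Q0.
have initial : \forall s \near (0 : K^o), forall n : 'I_N, W (s *: x_ n).
  apply: (@filter_forall _ _ (fun (n : 'I_N) (s : K^o) => W (s *: x_ n))
    (nbhs (0 : K^o)) (nbhs_filter _)) => n.
  have [[P' Q'] [/= P'0 Q'x] PQ'W] := Wscale (x_ n).
  apply: filterS P'0 => s P's; apply: (PQ'W (s, x_ n)); split => /=; first by [].
  exact: (nbhs_singleton Q'x).
have [eps /= eps0 epsP] :=
  (@nbhs_ballP K K^o 0 _).1 (filterI P0 initial).
exists eps => // s n seps.
have [|Ps sN] := epsP s; first by rewrite -ball_normE /= sub0r normrN.
have [nN|Nn] := ltnP n N; first exact: (sN (Ordinal nN)).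
by apply: (PQW (s, x_ n)); split => //=; exact: NQ.
Qed.

End TopologicalVectorSpaceTheory.

(** A pointwise null sequence of continuous linear maps on a barrelled space is
equicontinuous. For a closed convex [C] inside [W], the set [A] below is a barrel:
it is absorbing because each null sequence [L n x] is bounded, and the scalars [t]
make it balanced although [C] need not be. *)
Lemma barrelled_equicontinuous (K : numFieldType) (X Y : topologicalLmodType K)
    (L : nat -> {linear X -> Y}) (W : set Y) :
  barrelled_space X -> locally_convex_space Y ->
  (forall n, continuous (L n)) -> (forall x, L^~ x @ \oo --> (0 : Y)) ->
  nbhs 0 W ->
  nbhs (0 : X) [set x | forall n (t : K), `|t| <= 1 -> W (t *: L n x)].
Proof.
move=> [_ barrelX] lcY Lcont L0 W0.
have [C [C0 /convex_setP cC clC CW]] := closed_convex_nbhs0 lcY W0.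
pose A := [set x | forall n (t : K), `|t| <= 1 -> C (t *: L n x)].
suff /barrelX : barrel A by apply: filterS => x Ax n t t1; exact/CW/Ax.
split; first split.
- move=> s x s1 Ax n t t1; rewrite linearZ_LR scalerA; apply: Ax.
  by rewrite normrM mulr_ile1.
- apply/convex_setP => x y l l01 Ax Ay n t t1.
  have -> : t *: L n (l *: x + (1 - l) *: y) =
      l *: (t *: L n x) + (1 - l) *: (t *: L n y).
    rewrite linearD scalerDr [L n (l *: x)]linearZ_LR.
    by rewrite [L n (_ *: y)]linearZ_LR !scalerA (mulrC t l) (mulrC t (1 - l)).
  by apply: cC => //; [exact: Ax|exact: Ay].
- move=> x; have [eps eps0 epsP] := null_sequence_bounded C0 (L0 x).
  exists eps => // s seps n t t1; rewrite linearZ_LR scalerA.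
  by apply: epsP; rewrite normrM (le_lt_trans _ seps)// ler_piMl.
have -> : A = \bigcap_(i in [set i : nat * K | `|i.2| <= 1])
    ((fun x => i.2 *: L i.1 x) @^-1` C).
  by apply/seteqP; split=> [x Ax [n t] /= t1|x Ax n t t1];
    [exact: Ax|exact: (Ax (n, t))].
apply: closed_bigI => -[n t] _ /=; apply: preimage_closed => // x _.
by apply: cvg_lmodZ; [exact: cvg_cst|exact: Lcont].
Qed.

(** * Coordinates and shifts in a topological sequence space *)

Section SequenceSpace.
Context (K : numFieldType) (E : pred (nat -> K)) (X : topologicalSequenceSpace E).
Context (e : nat -> X) (he : forall n, \val (e n) = unit_sequence K n).

Definition coordinate_projection (n : nat) (u : X) : X :=
  (\val u : nat -> K) n *: e n.

Lemma coordinate_projection_is_linear n : linear (coordinate_projection n).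
Proof.
move=> a u v; rewrite /coordinate_projection linearP /=.
by rewrite fctE scalerDl scalerA.
Qed.

HB.instance Definition _ n := GRing.isLinear.Build K X X *:%R
  (coordinate_projection n) (coordinate_projection_is_linear n).

Lemma coordinate_projection_continuous n : continuous (coordinate_projection n).
Proof.
move=> u; apply: cvg_lmodZ; last exact: cvg_cst.
exact: sequence_term_continuous.
Qed.

Lemma val_series (a : nat -> K) m k :
  (\val (series (fun n => a n *: e n) m) : nat -> K) k =
  if (k < m)%N then a k else 0.
Proof.
rewrite /series /=; elim: m => [|m IHm]; first by rewrite big_nil linear0.
rewrite big_nat_recr//= linearD /= fctE IHm linearZ /= he fctE.
rewrite /unit_sequence ltnS [in RHS]leq_eqVlt /GRing.scale /=.
case: eqP => [->|_] /=; first by rewrite ltnn add0r mulr1.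
by rewrite mulr0 addr0.
Qed.

(** The coordinates are continuous, and the [k]-th coordinate of the partial sums is
constantly [a k] from some point on. *)
Lemma basis_coefficientE (a : nat -> K) (u : X) :
  series (fun n => a n *: e n) @ \oo --> u -> a = \val u.
Proof.
move=> au; apply/funext => k.
have /= := cvg_comp _ _ au (@sequence_term_continuous _ _ X k u).
move=> auk; apply: (cvg_unique (@norm_hausdorff K K^o) _ auk).
apply: cvg_near_cst; exists k.+1 => // m /= km.
by rewrite val_series km.
Qed.

Lemma series_coordinates (u : X) : tvs_basis e ->
  series (fun n => (\val u : nat -> K) n *: e n) @ \oo --> u.
Proof. by move=> /(_ u)[a [au _]]; rewrite -(basis_coefficientE au). Qed.

Lemma exists_series_in_open (U : set X) : tvs_basis e -> open U -> U !=set0 ->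
  exists a m, U (series (fun n => a n *: e n) m).
Proof.
move=> be oU [u Uu]; exists (\val u).
have [m _ /(_ m (leqnn m))] := series_coordinates be (open_nbhs_nbhs (conj oU Uu)).
by exists m.
Qed.

Context (T : {linear X -> X})
  (hT : forall u : X, \val (T u) = backward_shift (\val u)).

Lemma val_iter_shift n (u : X) k :
  (\val (iter n T u) : nat -> K) k = (\val u : nat -> K) (n + k)%N.
Proof. by elim: n k => [|n IHn] k //=; rewrite hT /backward_shift IHn addSnnS. Qed.

(** Mixing is tested on the interior of the neighborhood of 0 that equicontinuity of
the projections provides, against the open set of sequences whose first term has
modulus greater than 1. *)
Lemma unit_sequence_cvg0_of_mixing :
  barrelled_space X -> tvs_basis e -> mixing T -> e @ \oo --> (0 : X).
Proof.
move=> hX be mT W W0.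
have Pcvg0 (u : X) : (coordinate_projection ^~ u) @ \oo --> (0 : X).
  exact: cvg_series_term0 (series_coordinates be).
have A0 := @barrelled_equicontinuous K X X coordinate_projection W hX hX.1
  coordinate_projection_continuous Pcvg0 W0.
set A := [set x | _] in A0.
pose V := [set v : X | 1 < `|(\val v : nat -> K) 0|].
have oV : open V.
  rewrite openE => v v1.
  exact: (@cvgr_norm_gt K K^o _ _ _ _ _
    (@sequence_term_continuous _ _ X 0 v) 1 v1).
have V0 : V !=set0.
  by exists (2 *: e 0); rewrite /V /= linearZ /= he fctE /unit_sequence eqxx
    /GRing.scale /= mulr1 normr_nat ltr1n.
have [N NP] := mT A° V (open_interior A) (ex_intro _ 0 A0) oV V0.
exists N => // n /= /NP[_ [[u /interior_subset Au <-]]].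
rewrite /V /= val_iter_shift addn0 => u1.
have u0 : (\val u : nat -> K) n != 0 by rewrite -normr_gt0 (lt_trans _ u1).
have := Au n ((\val u : nat -> K) n)^-1.
rewrite /coordinate_projection scalerA mulVf// scale1r; apply.
by rewrite normfV invf_le1 ?normr_gt0// ltW.
Qed.

(** The right shift need not be defined on [X], but finite combinations of the [e n]
can be shifted, and [u + w n] is the required perturbation of [u]. *)
Lemma mixing_of_unit_sequence_cvg0 :
  tvs_basis e -> e @ \oo --> (0 : X) -> mixing T.
Proof.
move=> be e0 U V oU U0 oV V0.
have [a [m Ua]] := exists_series_in_open be oU U0.
have [b [p Vb]] := exists_series_in_open be oV V0.
set u := series _ m in Ua; set v := series _ p in Vb.
pose w n := \sum_(0 <= k < p) b k *: e (n + k)%N.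
have w0 : w @ \oo --> (0 : X).
  have -> : 0 = \sum_(0 <= k < p) b k *: 0 :> X.
    by rewrite big1// => k _; rewrite scaler0.
  apply: cvg_lmod_sum => k; apply: cvg_lmodZ; first exact: cvg_cst.
  exact: (cvg_comp _ _ (cvg_addnr k) e0).
have [N1 _ N1P] : \forall n \near \oo, U (u + w n).
  have /= := cvg_lmodD _ (cvg_cst u) w0; rewrite addr0; apply.
  exact: open_nbhs_nbhs.
exists (maxn N1 m) => n; rewrite geq_max => /andP[/N1P Uun mn].
exists v; split=> //; exists (u + w n) => //.
apply/val_inj/funext => k.
rewrite val_iter_shift linearD /= fctE /u val_series ltnNge.
rewrite (leq_trans mn (leq_addr _ _)) /= add0r.
(* a series with shifted coefficients, so that its coordinates can be read off *)
have -> : w n = series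
    (fun j => (if (n <= j)%N then b (j - n)%N else 0) *: e j) (n + p).
  rewrite /series /= (big_cat_nat _ (leq_addr p n))//= big1_seq ?add0r; last first.
    move=> j /andP[_]; rewrite mem_index_iota => /= jn.
    by rewrite leqNgt jn scale0r.
  rewrite -{2}[n]add0n big_addn addKn; apply: eq_bigr => j _.
  by rewrite leq_addl addnK addnC.
by rewrite !val_series ltn_add2l leq_addr addKn.
Qed.

End SequenceSpace.

Theorem theorem1p3 (R : realType) (K : numFieldType)
    (hK : K = (R : numFieldType) \/ K = (R[i]%C : numFieldType))
    (E : pred (nat -> K)) (X : topologicalSequenceSpace E)
    (hX : barrelled_space X)
    (e : nat -> X) (he : forall n, \val (e n) = unit_sequence K n)
    (hbasis : tvs_basis e)
    (T : {linear X -> X}) (hTcont : continuous T)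
    (hT : forall u : X, \val (T u) = backward_shift (\val u)) :
  mixing T <-> e @ \oo --> (0 : X).
Proof.
split; last exact: mixing_of_unit_sequence_cvg0.
exact: unit_sequence_cvg0_of_mixing.
Qed.
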